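(* Let $m\ge 3$ and $I_2(m)=\langle s,t:s^2=t^2=(st)^m=1\rangle$. For every reflection $u\in I_2(m)$, the pair $(I_2(m),\langle u\rangle)$ is a Gelfand pair, and \[ \dim\mathscr A(I_2(m),\langle u\rangle,\mathbf 1)=\begin{cases}(m+1)/2,&m\text{ odd},\\ m/2+1,&m\text{ even}.\end{cases} \] If $m\equiv 2\pmod 4$, put $z=(st)^{m/2}$; then for every reflection $u$, $(I_2(m),\langle z,u\rangle)$ is a Gelfand pair of rank $(m+2)/4$. Finally, every index-two subgroup $K$ of $I_2(m)$ gives a rank-two Gelfand pair $(I_2(m),K)$.
   Context: For finite groups $H\le G$, $(G,H)$ is a Gelfand pair if $\mathrm{Ind}_H^G\mathbf 1$ is multiplicity-free. $\mathscr A(G,H,\mathbf 1)=e\,\mathbb CG\,e$ with $e=|H|^{-1}\sum_{h\in H}h$ is the double-coset algebra, and the rank of a Gelfand pair is the dimension of this algebra. Reflections are the conjugates of $s$ and $t$. *)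

(* Defs.v *)
From HB Require Import structures.
From mathcomp Require Import all_boot all_order all_algebra all_fingroup.
From mathcomp Require Import all_solvable all_field all_character.

Set Implicit Arguments.
Unset Strict Implicit.
Unset Printing Implicit Defensive.

Import GRing.Theory.
Local Open Scope group_scope.

(* G = <s, t | s^2 = t^2 = (st)^m = 1>, with s and t the distinguished
   generators. The group presented is finite, so the \isog clause says that G
   is isomorphic to it; the map sending the abstract generators to s and t is
   then a surjection between finite groups of the same order, so s and t do
   correspond to the abstract generators. *)
Definition dihedral_I2 (gT : finGroupType) (G : {group gT}) (s t : gT)
    (m : nat) : Prop :=
  [/\ G \isog Grp (x : y : x ^+ 2, y ^+ 2, (x * y) ^+ m),
      <<[set s; t]>> = G, s ^+ 2 = 1, t ^+ 2 = 1 & (s * t) ^+ m = 1].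

Lemma dihedral_I2_exists (m : nat) : 1 < m ->
  exists (gT : finGroupType) (G : {group gT}) (s t : gT), dihedral_I2 G s t m.
Proof.
move=> m_gt1; have isoD := @Grp'_dihedral m m_gt1.
have := isoD _ [group of 'D_m.*2]; rewrite homg_refl.
move/esym/existsP => [[s t]]; rewrite /= !xpair_eqE.
case/and4P => /eqP defD /eqP s2 /eqP t2 /eqP stm.
exists _, [group of 'D_m.*2], s, t; split=> //.
by rewrite -[RHS]defD joing_idl joing_idr.
Qed.

Definition reflections (gT : finGroupType) (G : {group gT}) (s t : gT) :
    {set gT} :=
  (s ^: G) :|: (t ^: G).

(* Complex characters take values in algC; the inner product below is the
   multiplicity of 'chi_i in the induced character. *)
Definition gelfand_pair (gT : finGroupType) (G H : {group gT}) : Prop :=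
  H \subset G /\
  forall i : Iirr G, ('['Ind[G, H] 1, 'chi_i]_G <= 1)%R.

(* The group algebra is realised as the span of the regular representation,
   which is faithful, so that gset_mx _ G H is the sum of the elements of H. *)
Definition avg_idempotent (gT : finGroupType) (G H : {group gT}) :
    'M[algC]_#|G| :=
  (#|H|%:R^-1 *: gset_mx algC G H)%R.

(* The matrix whose row space is (the encoding by mxvec of) e CG e; mulsmx
   denotes the span of the pairwise products, and e CG e is already a
   subspace. *)
Definition double_coset_algebra (gT : finGroupType) (G H : {group gT}) :
    'A[algC]_#|G| :=
  (mxvec (avg_idempotent G H) * group_ring algC G
     * mxvec (avg_idempotent G H))%MS.

Definition double_coset_rank (gT : finGroupType) (G H : {group gT}) : nat :=
  \rank (double_coset_algebra G H).

(* Main.v *)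
Require Import Defs.
From mathcomp Require Import all_boot all_order all_algebra all_fingroup.
From mathcomp Require Import all_solvable all_field all_character.
From mathcomp Require Import zify.

(* If every double coset of H is closed under inversion, then inversion induces
   an anti-automorphism of e CG e that is the identity, so e CG e is
   commutative and (G, H) is a Gelfand pair (Gelfand's trick). The sums over
   double cosets form a basis of e CG e, so the rank counts double cosets.
   With r = st, every subgroup <r^k, u> containing a reflection u meets this
   condition: u inverts every rotation and every reflection is its own
   inverse. Its double cosets are represented by rotations, r^i and r^j being
   equivalent iff i = j or i = -j mod k, which leaves k/2 + 1 classes; <u> is
   the case k = m and <z, u> the case k = m/2. *)

Set Implicit Arguments.
Unset Strict Implicit.
Unset Printing Implicit Defensive.

Import GRing.Theory Num.Theory.
Local Open Scope group_scope.

(** * Double cosets and their partition of the group *)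

Definition double_cosets (gT : finGroupType) (G H : {set gT}) :
    {set {set gT}} :=
  [set H :* g * H | g in G].

Lemma mem_dcoset (gT : finGroupType) (H : {group gT}) (g : gT) :
  g \in H :* g * H.
Proof. by rewrite -{1}[g]mulg1 mem_mulg ?rcoset_refl. Qed.

Lemma dcosetP (gT : finGroupType) (H : {group gT}) (g y : gT) :
  reflect (exists2 h, h \in H & exists2 k, k \in H & y = h * g * k)
          (y \in H :* g * H).
Proof.
apply: (iffP mulsgP) => [[_ k /rcosetP[h Hh ->] Hk ->] | [h Hh [k Hk ->]]].
  by exists h => //; exists k.
by exists (h * g) k; rewrite ?mem_rcoset ?mulgK.
Qed.

Lemma dcoset_eq (gT : finGroupType) (H : {group gT}) (g y : gT) :
  y \in H :* g * H -> H :* y * H = H :* g * H.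
Proof.
case/dcosetP=> h Hh [k Hk ->].
by rewrite !rcosetM (rcoset_id Hh) -mulgA (lcoset_id Hk).
Qed.

Lemma mem_dcosetMl (gT : finGroupType) (H : {group gT}) (g h y : gT) :
  h \in H -> (h * y \in H :* g * H) = (y \in H :* g * H).
Proof.
by move=> Hh; rewrite -{1}(lcoset_id Hh) -!mulgA mem_lcoset mulKg.
Qed.

Lemma mem_dcosetMr (gT : finGroupType) (H : {group gT}) (g h y : gT) :
  h \in H -> (y * h \in H :* g * H) = (y \in H :* g * H).
Proof.
by move=> Hh; rewrite -{2}(rcoset_id Hh) mulgA mem_rcoset mulgK.
Qed.

Lemma dcoset_sub (gT : finGroupType) (G H : {group gT}) (g : gT) :
  H \subset G -> g \in G -> H :* g * H \subset G.
Proof.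
move=> sHG Gg; apply/subsetP=> y /dcosetP[h Hh [k Hk ->]].
by rewrite !groupM // (subsetP sHG).
Qed.

Lemma double_cosets_partition (gT : finGroupType) (G H : {group gT}) :
  H \subset G -> partition (double_cosets G H) G.
Proof.
move=> sHG; apply/and3P; split.
- rewrite eqEsubset; apply/andP; split.
    by apply/bigcupsP=> _ /imsetP[g Gg ->]; apply: dcoset_sub.
  apply/subsetP=> g Gg; apply/bigcupP; exists (H :* g * H).
    by apply/imsetP; exists g.
  exact: mem_dcoset.
- apply/trivIsetP=> _ _ /imsetP[x Gx ->] /imsetP[y Gy ->].
  apply: contraR => /pred0Pn[w /andP[/= /dcoset_eq <- /dcoset_eq <-]].
  exact: eqxx.
by apply/imsetP=> -[g _ Hg0]; have := mem_dcoset H g; rewrite -Hg0 inE.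
Qed.

(** * Linear independence of sums over the blocks of a partition *)

Lemma gring_proj_gset (F : fieldType) (gT : finGroupType) (G : {group gT})
    (A : {set gT}) (x : gT) : A \subset G -> x \in G ->
  gring_proj x (gset_mx F G A) = ((x \in A)%:R)%R.
Proof.
move=> sAG Gx; rewrite linear_sum /=.
have [Ax | nAx] := boolP (x \in A).
  rewrite (bigD1 x) //= gring_projE // eqxx big1 ?addr0 // => y /andP[Ay ne_yx].
  by rewrite gring_projE ?(subsetP sAG) // eq_sym (negPf ne_yx).
apply: big1 => y Ay; rewrite gring_projE ?(subsetP sAG y) //.
by case: eqP nAx => // ->; rewrite Ay.
Qed.

(** Blocks are nonempty and pairwise disjoint, so in a linear relation the coefficient at a point of
    one block sees that block alone. *)
Lemma gset_mx_free (F : fieldType) (gT : finGroupType) (G : {group gT})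
    (P : {set {set gT}}) : partition P G ->
  row_free (\matrix_(k < #|P|) mxvec (gset_mx F G (enum_val k)))%R.
Proof.
case/and3P=> /eqP defG tiP P0; rewrite -kermx_eq0.
have sPG A : A \in P -> A \subset G by rewrite -defG => PA; apply: bigcup_sup.
apply/rowV0P=> v /sub_kermxP; rewrite mulmx_sum_row => v0.
apply/rowP=> k /[1!mxE]; have Pk := enum_valP k.
have /set0Pn[x kx] : enum_val k != set0 by apply: contraNneq P0 => <-.
have Gx := subsetP (sPG _ Pk) x kx.
(* The right-hand zero is read as the coefficient at [x] of the zero vector, for which the relation
   [v0] is then substituted. *)
transitivity (@gring_proj F _ G x (vec_mx 0) 0 0)%R; last first.
  by rewrite !linear0 !mxE.
rewrite -{}v0 !linear_sum (bigD1 k) //= 2!linearZ /= rowK mxvecK.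
rewrite gring_proj_gset ?sPG // kx big1 ?addr0 => [|j ne_jk].
  by rewrite !mxE mulr1.
rewrite rowK 2!linearZ /= mxvecK gring_proj_gset ?sPG ?enum_valP //.
have /trivIsetP/(_ _ _ (enum_valP j) Pk) := tiP.
rewrite (inj_eq enum_val_inj) => /(_ ne_jk)/disjointFl-> //.
by rewrite scaler0.
Qed.

(** * Averaging over a subgroup in a representation *)

Lemma sum_group_repr (F : fieldType) (gT : finGroupType) (G H : {group gT})
    (n : nat) (rG : mx_representation F G n) (h : gT) :
    H \subset G -> h \in H ->
  ((\sum_(x in H) rG x) *m rG h = \sum_(x in H) rG x)%R
  /\ (rG h *m (\sum_(x in H) rG x) = \sum_(x in H) rG x)%R.
Proof.
move=> sHG Hh; have Gh := subsetP sHG h Hh.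
rewrite mulmx_suml mulmx_sumr; split.
  rewrite [RHS](reindex_inj (mulIg h)); apply: eq_big => x.
    by rewrite groupMr.
  by move=> Hx; rewrite repr_mxM // (subsetP sHG).
rewrite [RHS](reindex_inj (mulgI h)); apply: eq_big => x.
  by rewrite groupMl.
by move=> Hx; rewrite repr_mxM // (subsetP sHG).
Qed.

(** The action of the averaging idempotent in any representation: the regular one serves the rank
    computation, the irreducible ones Gelfand's trick. *)
Definition repr_avg (gT : finGroupType) (G : {group gT}) (n : nat)
    (rG : mx_representation algC G n) (H : {set gT}) : 'M[algC]_n :=
  (#|H|%:R^-1 *: \sum_(x in H) rG x)%R.

Section Average.

Variables (gT : finGroupType) (G H : {group gT}) (n : nat).
Variable rG : mx_representation algC G n.
Hypothesis sHG : H \subset G.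
Local Notation e := (repr_avg rG H).

Let nzH : (#|H|%:R != 0 :> algC)%R.
Proof. by rewrite pnatr_eq0 -lt0n cardG_gt0. Qed.

Lemma repr_avgMr (h : gT) : h \in H -> (e *m rG h = e)%R.
Proof. by move=> Hh; rewrite -scalemxAl (sum_group_repr _ sHG Hh).1. Qed.

Lemma repr_avgMl (h : gT) : h \in H -> (rG h *m e = e)%R.
Proof. by move=> Hh; rewrite -scalemxAr (sum_group_repr _ sHG Hh).2. Qed.

Lemma repr_avg_id : (e *m e = e)%R.
Proof.
rewrite {2}/repr_avg -scalemxAr mulmx_sumr (eq_bigr (fun=> e)).
  by rewrite sumr_const -scaler_nat scalerA mulVf // scale1r.
by move=> h; apply: repr_avgMr.
Qed.

Lemma repr_avg_dcoset (g y : gT) : g \in G -> y \in H :* g * H ->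
  (e *m rG y *m e = e *m rG g *m e)%R.
Proof.
move=> Gg /dcosetP[h Hh [k Hk ->]].
have Gh := subsetP sHG h Hh; have Gk := subsetP sHG k Hk.
rewrite !repr_mxM ?groupM //.
by rewrite !mulmxA repr_avgMr // -!mulmxA repr_avgMl.
Qed.

(** The sum is fixed by [H] on both sides, so multiplying it by [e] on both sides changes nothing;
    but [e] turns every term into the same matrix. This avoids counting how often a product
    [h * g * k] takes a given value. *)
Lemma sum_dcoset_repr (g : gT) : g \in G ->
  (\sum_(y in (H :* g * H)%g) rG y
     = #|(H :* g * H)%g|%:R *: (e *m rG g *m e))%R.
Proof.
move=> Gg; set D := H :* g * H; set S := (\sum_(y in D) rG y)%R.
have sDG := subsetP (dcoset_sub sHG Gg); have sH := subsetP sHG.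
have lS h : h \in H -> (rG h *m S = S)%R.
  move=> Hh; rewrite mulmx_sumr [RHS](reindex_inj (mulgI h)).
  apply: eq_big => y; last by move=> Dy; rewrite repr_mxM ?(sDG y) ?(sH h).
  by rewrite mem_dcosetMl.
have rS h : h \in H -> (S *m rG h = S)%R.
  move=> Hh; rewrite mulmx_suml [RHS](reindex_inj (mulIg h)).
  apply: eq_big => y; last by move=> Dy; rewrite repr_mxM ?(sDG y) ?(sH h).
  by rewrite mem_dcosetMr.
have <- : (e *m S *m e = S)%R.
  rewrite {1}/repr_avg -scalemxAl mulmx_suml (eq_bigr (fun=> S)) //.
  rewrite sumr_const -scaler_nat scalerA mulVf // scale1r.
  rewrite /repr_avg -scalemxAr mulmx_sumr (eq_bigr (fun=> S)) //.
  by rewrite sumr_const -scaler_nat scalerA mulVf // scale1r.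
rewrite mulmx_sumr mulmx_suml (eq_bigr (fun=> e *m rG g *m e)%R).
  by rewrite sumr_const scaler_nat.
by move=> y; apply: repr_avg_dcoset.
Qed.

End Average.

(** * The dimension of the double-coset algebra *)

Lemma double_coset_rankE (gT : finGroupType) (G H : {group gT}) :
  H \subset G -> double_coset_rank G H = #|double_cosets G H|.
Proof.
move=> sHG; have partG := double_cosets_partition sHG.
pose aG := regular_repr algC G.
pose B := (\matrix_(k < #|double_cosets G H|)
  mxvec (gset_mx algC G (enum_val k)))%R.
have BD A : A \in double_cosets G H -> (gset_mx algC G A \in B)%MS.
  move=> PA; rewrite (eq_row_sub (enum_rank_in PA A)) // rowK.
  by rewrite enum_rankK_in.
have nzD g : (#|(H :* g * H)%g|%:R != 0 :> algC)%R.
  by rewrite pnatr_eq0 -lt0n; apply/card_gt0P; exists g; apply: mem_dcoset.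
suffices defB : (double_coset_algebra G H :=: B)%MS.
  by rewrite /double_coset_rank defB; apply/eqP/gset_mx_free.
rewrite /double_coset_algebra; have := sum_dcoset_repr aG sHG.
rewrite -[avg_idempotent G H]/(repr_avg aG H).
move: (repr_avg aG H) => e eD.
have Be g : g \in G -> (e *m aG g *m e \in B)%MS.
  move=> Gg; have := BD (H :* g * H) (imset_f _ Gg).
  rewrite /gset_mx eD // linearZ /=.
  by rewrite (eqmx_scale _ (nzD g)).
(* Each double-coset sum is a multiple of some [e *m aG g *m e], hence lies in the algebra. *)
apply/eqmxP/andP; split; last first.
  apply/row_subP=> k; rewrite rowK.
  have /imsetP[g Gg ->] := enum_valP k.
  rewrite /gset_mx eD // linearZ scalemx_sub //=.
  by rewrite !mem_mulsmx //; apply: envelop_mx_id.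
(* Conversely, the outer factors are scalar multiples of [e] and the middle one is a combination of
   group elements, so linearity reduces to [Be]. *)
apply/mulsmx_subP=> _ E /mulsmxP[E1 E1e [R1 R1G ->]] /sub_rVP[c defE].
have {defE} -> : E = (c *: e)%R.
  by rewrite -[E]mxvecK defE linearZ /= mxvecK.
rewrite -scalemxAr mulmx_suml !linear_sum /= summx_sub // => i _.
have /sub_rVP[d defE1] := E1e i; have /envelop_mxP[a ->] := R1G i.
have -> : (E1 i = d *: e)%R by rewrite -[E1 i]mxvecK defE1 linearZ /= mxvecK.
rewrite -!scalemxAl mulmx_sumr mulmx_suml !linearZ !scalemx_sub //=.
rewrite linear_sum summx_sub // => g Gg /=.
by rewrite -scalemxAr -scalemxAl linearZ scalemx_sub ?Be.
Qed.

(** * Gelfand's trick *)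

Lemma mul_delta_mxE (R : pzSemiRingType) (m n p q : nat) (X : 'M[R]_(m, n))
    (Y : 'M_(p, q)) i j a b :
  ((X *m delta_mx i j *m Y) a b = X a i * Y j b)%R.
Proof.
rewrite -(mul_delta_mx (0%R : 'I_1)) mulmxA -colE -mulmxA -rowE.
by rewrite !mxE big_ord1 !mxE.
Qed.

(* Comparing the entries of both sides of the hypothesis at matrix units and
   contracting the free indices pairwise leaves an identity in \tr e only. *)
Lemma mxtrace_idem_corner_comm (R : comPzRingType) (n : nat) (e : 'M[R]_n) :
    (e *m e = e)%R ->
    (forall A B : 'M_n, e *m A *m e *m (e *m B *m e)
       = e *m B *m e *m (e *m A *m e))%R ->
  (\tr e ^+ 3 = \tr e)%R.
Proof.
move=> ee eC; set t := (\tr e)%R.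
have eE a b : (e a b = \sum_j e a j * e j b)%R by rewrite -{1}ee mxE.
have eD i j k l a b :
    (e a i * e j k * e l b = e a k * e l i * e j b)%R.
  have := eC (delta_mx i j) (delta_mx k l).
  rewrite !mulmxA -!(mulmxA _ e e) ee => /matrixP/(_ a b).
  by rewrite !mul_delta_mxE.
have e2 i l a b : (e a i * t * e l b = e a b * e l i)%R.
  rewrite (eE a b) /t /mxtrace mulr_sumr !mulr_suml.
  by apply: eq_bigr => j _; rewrite [LHS]eD mulrAC.
have e1 l b : (t * t * e l b = e l b)%R.
  rewrite [RHS]eE {1}/t /mxtrace !mulr_suml.
  by apply: eq_bigr => i _; rewrite e2 mulrC.
rewrite !exprS expr0 mulr1 mulrA {3 4}/t /mxtrace mulr_sumr.
exact: eq_bigr.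
Qed.

(** By Frobenius reciprocity the multiplicity is the trace of [e] on the irreducible module, a
    natural number. The compressions [c g] commute and span the whole corner of the matrix algebra
    cut out by [e], so this number equals its cube and is at most 1. *)
Lemma gelfand_trick (gT : finGroupType) (G H : {group gT}) :
    H \subset G -> (forall g, g \in G -> g^-1 \in H :* g * H) ->
  gelfand_pair G H.
Proof.
move=> sHG invG; split=> // i; rewrite -Frobenius_reciprocity.
have sH := subsetP sHG.
pose e := repr_avg 'Chi_i H.
have ee : (e *m e = e)%R := repr_avg_id _ sHG.
pose c g := (e *m 'Chi_i g *m e)%R.
have cV g : g \in G -> c g^-1 = c g.
  by move=> Gg; apply: repr_avg_dcoset => //; apply: invG.
have eE : e = (#|H|%:R^-1 *: \sum_(k in H) 'Chi_i k)%R by [].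
clearbody e.
have cM g h : g \in G -> h \in G ->
    (c g *m c h = #|H|%:R^-1 *: \sum_(k in H) c (g * k * h)%g)%R.
  move=> Gg Gh; rewrite /c !mulmxA -(mulmxA _ e e) ee.
  rewrite {2}eE -scalemxAr -!scalemxAl; congr (_ *: _)%R.
  rewrite mulmx_sumr !mulmx_suml; apply: eq_bigr => k Hk.
  by rewrite !repr_mxM ?groupM ?(sH k) // !mulmxA.
(* Inversion reverses [g * k * h] but fixes every value of [c], and [k^-1] runs over [H] with
   [k]. *)
have cC g h : g \in G -> h \in G -> (c g *m c h = c h *m c g)%R.
  move=> Gg Gh; rewrite -[in RHS](cV g) // -[in RHS](cV h) //.
  rewrite !cM ?groupV //.
  congr (_ *: _)%R; rewrite [RHS](reindex_inj invg_inj).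
  apply: eq_big => [k | k Hk]; first by rewrite groupV.
  by rewrite -cV ?groupM ?(sH k) // !invMg mulgA.
have tr3 : (\tr e ^+ 3 = \tr e)%R.
  apply: mxtrace_idem_corner_comm => // A B.
  (* Over [algC] an irreducible representation is absolutely irreducible, so every matrix is a
     combination of the ['Chi_i g]. *)
  have /mx_abs_irrP[_ [a defA]] := groupC (socle_irr (socle_of_Iirr i)).
  have cE C : (e *m C *m e = \sum_(g in G) a g C *: c g)%R.
    rewrite {1}(defA C) mulmx_sumr mulmx_suml; apply: eq_bigr => g _.
    by rewrite -scalemxAr -scalemxAl.
  rewrite !cE !mulmx_suml.
  under eq_bigr => g _ do rewrite mulmx_sumr.
  under [RHS]eq_bigr => g _ do rewrite mulmx_sumr.
  rewrite exchange_big; apply: eq_bigr => h Gh; apply: eq_bigr => g Gg.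
  rewrite -!scalemxAl -!scalemxAr !scalerA mulrC; congr (_ *: _)%R.
  exact: cC.
have tre : (\tr e = '[1, 'Res[H] 'chi_i]_H)%R.
  rewrite cfdotC_char ?cfun1_char ?cfRes_char ?irr_char // cfdotE.
  rewrite eE linearZ linear_sum /=; congr (_ * _)%R.
  apply: eq_bigr => k Hk.
  rewrite cfun1E Hk conjC1 mulr1 cfResE // -irrRepr cfunE.
  by rewrite (sH k).
have /natrP[n def_n] : ('[1, 'Res[H] 'chi_i]_H \is a Num.nat)%R.
  by rewrite Cnat_cfdot_char ?cfun1_char ?cfRes_char ?irr_char.
move: tr3; rewrite tre def_n -natrX => /eqP; rewrite eqr_nat lern1.
by case: n {def_n} => [|[|n]] //; rewrite -[eqbRHS]expn1 eqn_exp2l.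
Qed.

(** * Subgroups of index two *)

Lemma index2_mulV (gT : finGroupType) (G K : {group gT}) (x y : gT) :
    K \subset G -> #|G : K| = 2 -> x \in G -> x \notin K ->
    y \in G -> y \notin K ->
  x * y^-1 \in K.
Proof.
move=> sKG iK Gx nKx Gy nKy.
have neK w : w \notin K -> K :* w != K.
  by apply: contraNneq => <-; apply: rcoset_refl.
have defKG : [set K :* 1; K :* y] = rcosets K G.
  apply/eqP; rewrite eqEcard subUset !sub1set !mem_rcosets !(mulSGid sKG).
  by rewrite group1 Gy cards2 rcoset1 eq_sym neK // [X in X <= _]iK.
have : K :* x \in rcosets K G by rewrite mem_rcosets (mulSGid sKG).
rewrite -defKG !inE rcoset1 (negPf (neK x nKx)) /= => /eqP defKx.
by rewrite -mem_rcoset -defKx rcoset_refl.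
Qed.

(** Such a [K] is normal, so its double cosets are its two cosets, and in a quotient of order two
    every element is its own inverse. *)
Lemma gelfand_pair_index2 (gT : finGroupType) (G K : {group gT}) :
    K \subset G -> #|G : K| = 2 ->
  gelfand_pair G K /\ double_coset_rank G K = 2.
Proof.
move=> sKG iK; have nKG := normal_norm (index2_normal sKG iK).
have dcE g : g \in G -> K :* g * K = K :* g.
  by move=> Gg; rewrite -mulgA -norm_rlcoset ?(subsetP nKG) // mulgA mulGid.
split.
  apply: gelfand_trick => // g Gg; rewrite dcE //.
  have [Kg | nKg] := boolP (g \in K); first by rewrite rcoset_id ?groupV.
  by rewrite mem_rcoset (index2_mulV sKG iK) ?groupV.
rewrite double_coset_rankE // -[RHS]iK /double_cosets (eq_in_imset dcE).
by apply: eq_card => A; apply/imsetP/rcosetsP.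
Qed.

(** * Rotations and reflections in the dihedral group *)

(** [G] and the standard ['D_m.*2] have the same presentation, so each is a homomorphic image of the
    other. *)
Lemma card_dihedral_I2 (gT : finGroupType) (G : {group gT}) (s t : gT) m :
  1 < m -> dihedral_I2 G s t m -> #|G| = m.*2.
Proof.
move=> m_gt1 [isoG _ _ _ _]; rewrite -(card_dihedral m_gt1).
have isoD := Grp'_dihedral m_gt1.
by apply/card_isog; rewrite isogEhom isoD isoGrp_hom // isoG isoGrp_hom.
Qed.

(** The relations bound [#[r]] by [m] and [#[s]] by 2, while [G] is the product of the two cycles
    and has order [m.*2]; this forces [#[r] = m]. If [s] were a rotation, [G] would reduce to
    [<[r]>], which is too small. *)
Lemma dihedral_I2_rotation (gT : finGroupType) (G : {group gT}) (s t : gT) m :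
    1 < m -> dihedral_I2 G s t m ->
  [/\ #[s * t] = m, <[s * t]> <| G, #|G : <[s * t]>| = 2, s \notin <[s * t]>
    & t \notin <[s * t]>].
Proof.
move=> m_gt1 dG; have oG := card_dihedral_I2 m_gt1 dG.
case: dG => _ defG s2 t2 rm; set r := s * t.
have m_gt0 := ltnW m_gt1.
have Gs : s \in G by rewrite -defG mem_gen ?set21.
have Gt : t \in G by rewrite -defG mem_gen ?set22.
have sRG : <[r]> \subset G by rewrite cycle_subG groupM.
have sV : s^-1 = s by apply/eqP; rewrite eq_invg_mul -expg2 s2.
have tV : t^-1 = t by apply/eqP; rewrite eq_invg_mul -expg2 t2.
have rs : r ^ s = r^-1 by rewrite /r conjgE -!mulgA mulKg invMg sV tV.
have rt : r ^ t = r^-1 by rewrite /r conjgE invMg sV tV -!mulgA -expg2 t2 mulg1.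
have nRG : G \subset 'N(<[r]>).
  rewrite -defG gen_subG subUset !sub1set.
  by apply/andP; split; apply/normP; rewrite -cycleJ ?rs ?rt cycleV.
have sG (A : {group gT}) : s \in A -> r \in A -> G \subset A.
  move=> As Ar; rewrite -defG gen_subG subUset !sub1set As.
  by rewrite -(mulKg s t) groupM ?groupV.
have le_rm : #[r] <= m by rewrite dvdn_leq // order_dvdn rm.
have le_s2 : #[s] <= 2 by rewrite dvdn_leq // order_dvdn s2.
have leG : #|G| <= #[r] * #[s].
  rewrite !orderE mul_cardG -norm_joinEr; last first.
    by rewrite cycle_subG (subsetP nRG).
  apply: leq_trans (leq_pmulr _ (cardG_gt0 _)).
  by apply/subset_leq_card/sG; apply: mem_gen; rewrite inE cycle_id ?orbT.
have or : #[r] = m.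
  apply/eqP; rewrite eqn_leq le_rm -leq_double -oG -muln2.
  by rewrite (leq_trans leG) ?leq_mul.
have snR : s \notin <[r]>.
  apply/negP => Rs; have := subset_leq_card (sG _ Rs (cycle_id r)).
  by rewrite oG -orderE or -addnn -[leqRHS]addn0 leq_add2l leqNgt m_gt0.
split=> //; first by rewrite /normal sRG.
  by rewrite -divgS // oG -orderE or -muln2 mulKn.
by apply: contra snR => Rt; rewrite -(mulgK t s) groupM ?groupV ?cycle_id.
Qed.

(** It suffices to check [s] and [t], since [<[r]>] is normal and all four properties survive
    conjugation; inverting [r] is enough to invert all its powers. *)
Lemma dihedral_I2_reflection (gT : finGroupType) (G : {group gT})
    (s t u : gT) m : 1 < m -> dihedral_I2 G s t m -> u \in reflections G s t ->
  [/\ u \in G, u \notin <[s * t]>, u ^+ 2 = 1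
    & {in <[s * t]>, forall x, x ^ u = x^-1}].
Proof.
move=> m_gt1 dG.
have [_ /andP[sRG nRG] _ snR tnR] := dihedral_I2_rotation m_gt1 dG.
case: dG => _ defG s2 t2 rm; set r := s * t in sRG nRG snR tnR *.
have Gs : s \in G by rewrite -defG mem_gen ?set21.
have Gt : t \in G by rewrite -defG mem_gen ?set22.
suffices conjR v : v \in G -> v \notin <[r]> -> v ^+ 2 = 1 -> r ^ v = r^-1 ->
    forall u, u \in v ^: G -> [/\ u \in G, u \notin <[r]>, u ^+ 2 = 1
      & {in <[r]>, forall x, x ^ u = x^-1}].
  have sV : s^-1 = s by apply/eqP; rewrite eq_invg_mul -expg2 s2.
  have tV : t^-1 = t by apply/eqP; rewrite eq_invg_mul -expg2 t2.
  rewrite inE => /orP[]; apply: conjR => //.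
    by rewrite /r conjgE -!mulgA mulKg invMg sV tV.
  by rewrite /r conjgE invMg sV tV -!mulgA -expg2 t2 mulg1.
move=> Gv nRv v2 rv _ /imsetP[g Gg ->].
have nRg := subsetP nRG g Gg.
split; [exact: groupJ | by rewrite memJ_norm | by rewrite -conjXg v2 conj1g |].
(* With [x] written as a [g]-conjugate of a power of [r], the action of [v ^ g] on [x] becomes that
   of [v] on this power. *)
move=> x Rx; have /cycleP[i def_x] : x ^ g^-1 \in <[r]>.
  by rewrite memJ_norm ?groupV.
have {def_x} -> : x = (r ^+ i) ^ g by rewrite -def_x conjgKV.
by rewrite -conjJg conjXg rv expgVn conjVg.
Qed.

(** * Double cosets of the subgroup generated by [r ^+ k] and a reflection *)

Section ReflectionDoubleCosets.

Variables (gT : finGroupType) (G : {group gT}) (r u : gT) (k : nat).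
Hypotheses (sRG : <[r]> \subset G) (iRG : #|G : <[r]>| = 2).
Hypotheses (Gu : u \in G) (nRu : u \notin <[r]>) (u2 : u ^+ 2 = 1).
Hypothesis ru : {in <[r]>, forall x, x ^ u = x^-1}.
Hypotheses (k_gt0 : 0 < k) (k_dvd : k %| #[r]).

Local Notation C := <[r ^+ k]>%g.
Local Notation H := <<[set r ^+ k; u]>>%G.

Let Rr n : r ^+ n \in <[r]>. Proof. by rewrite groupX ?cycle_id. Qed.
Let sCR : C \subset <[r]>. Proof. by rewrite cycle_subG. Qed.
Let Hu : u \in H. Proof. by rewrite mem_gen ?set22. Qed.
Let Hrk : r ^+ k \in H. Proof. by rewrite mem_gen ?set21. Qed.
Let uV : u^-1 = u. Proof. by apply/eqP; rewrite eq_invg_mul -expg2 u2. Qed.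

Lemma reflection_sub : H \subset G.
Proof. by rewrite gen_subG subUset !sub1set Gu (subsetP sRG). Qed.

(** As [u] inverts [r ^+ k], it normalises [C], so [H] is the product of [C] and [<[u]>]; the parity
    of the exponent of [u] separates the two cases. *)
Lemma reflection_mulP (h : gT) : h \in H ->
  exists2 x, x \in C & h = x \/ h = x * u.
Proof.
have nCu : <[u]> \subset 'N(C).
  by rewrite cycle_subG; apply/normP; rewrite -cycleJ ru // cycleV.
have defH : H = C * <[u]> :> {set gT}.
  by rewrite -norm_joinEr //= joing_idl joing_idr.
have -> : (h \in H) = (h \in C * <[u]>) by rewrite -defH.
case/mulsgP=> x w Cx /cycleP[i ->] ->; exists x => //.
rewrite -(odd_double_half i) expgD -mul2n expgM u2 expg1n mulg1.
by case: (odd i); [right | left; rewrite mulg1].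
Qed.

Lemma reflection_cosetP (g : gT) : g \in G ->
  exists2 x, x \in <[r]> & g = x \/ g = x * u.
Proof.
move=> Gg; have [Rg | nRg] := boolP (g \in <[r]>); first by exists g; auto.
exists (g * u^-1); first exact: (index2_mulV (K := <[r]>%G) sRG).
by right; rewrite mulgKV.
Qed.

Lemma reflection_dcosetV (g : gT) : g \in G -> g^-1 \in H :* g * H.
Proof.
case/reflection_cosetP=> x Rx [->|->].
  apply/dcosetP; exists u => //; exists u => //.
  by rewrite -ru // conjgE uV mulgA.
suffices -> : (x * u)^-1 = x * u by apply: mem_dcoset.
by rewrite invMg uV -(ru Rx) conjgE uV !mulgA -expg2 u2 mul1g.
Qed.

(* The reflections in the two factors of H must cancel, and a rotation carried
   across a reflection is inverted. *)
Lemma rotation_dcoset (g y : gT) : g \in <[r]> -> y \in <[r]> ->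
  y \in H :* g * H -> y * g^-1 \in C \/ y * g \in C.
Proof.
have cR : {in <[r]> &, forall x y, x * y = y * x}.
  by move=> a b Ra Rb; apply: (centsP (cycle_abelian r)).
move=> Rg Ry /dcosetP[_ /reflection_mulP[x Cx [->|->]]
  [_ /reflection_mulP[z Cz [->|->]] def_y]];
  have Rx := subsetP sCR x Cx; have Rz := subsetP sCR z Cz;
  move: Ry; rewrite {y}def_y.
- by left; rewrite (cR (x * g)) ?(groupM Rx Rg) // -mulgA mulgK groupM.
- by rewrite mulgA groupMl ?(negPf nRu) // !groupM.
- by rewrite -!mulgA groupMl // groupMr ?(groupM Rg Rz) // (negPf nRu).
move=> _; right; have -> : x * u * g * (z * u) * g = x * (u * (g * z) * u) * g.
  by rewrite !mulgA.
have /= := ru (groupM Rg Rz); rewrite conjgE uV mulgA => ->.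
by rewrite invMg -!mulgA mulVg mulg1 groupM ?groupV.
Qed.

Lemma mem_cycleX_dvdn (n : nat) : (r ^+ n \in C) = (k %| n).
Proof.
apply/idP/idP=> [/cycleP[c /eqP] | /dvdnP[c ->]].
  (* Exponents of [r] count modulo [#[r]]; since [k] divides [#[r]], the congruence descends to one
     modulo [k]. *)
  rewrite -expgM eq_expg_mod_order => /eqP eq_n.
  by rewrite /dvdn -(modn_dvdm n k_dvd) eq_n modn_dvdm // modnMr.
by rewrite mulnC expgM mem_cycle.
Qed.

Lemma card_reflection_double_cosets : #|double_cosets G H| = (k %/ 2 + 1)%N.
Proof.
pose F (i : 'I_(k %/ 2).+1) := H :* r ^+ i * H.
have defD : double_cosets G H = F @: setT.
  apply/eqP; rewrite eqEsubset; apply/andP; split; last first.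
    apply/subsetP=> _ /imsetP[i _ ->].
    exact/imset_f/(subsetP sRG).
  apply/subsetP=> _ /imsetP[g Gg ->].
  have [_ /cycleP[n ->] def_g] := reflection_cosetP Gg.
  have -> : H :* g * H = H :* r ^+ n * H.
    by case: def_g => -> //; apply: dcoset_eq; rewrite mem_dcosetMr ?mem_dcoset.
  suffices [i Fi] : exists i : 'I_(k %/ 2).+1, r ^+ n \in F i.
    by apply/imsetP; exists i; rewrite ?inE //; apply: dcoset_eq.
  have Hrq q : r ^+ (k * q) \in H by rewrite expgM groupX.
  have [le_nk | lt_kn] := leqP (n %% k) (k %/ 2).
    exists (Ordinal (le_nk : n %% k < (k %/ 2).+1)).
    rewrite /F /= {1}(divn_eq n k) addnC expgD mulnC.
    by rewrite mem_dcosetMr ?mem_dcoset.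
  (* A residue above [k %/ 2] is replaced by its negative modulo [k]. *)
  have lt_nk : k - n %% k < (k %/ 2).+1 by clear -lt_kn; lia.
  exists (Ordinal lt_nk); rewrite /F /=.
  (* Conjugation by [u] turns the exponent [k - n %% k] into [n %% k - k]; adding [k * (n %/ k).+1]
     restores [n]. *)
  apply/dcosetP; exists u => //; exists (u * r ^+ (k * (n %/ k).+1)).
    by rewrite groupM.
  have := ru (Rr (k - n %% k)); rewrite conjgE uV !mulgA => ->.
  apply: (mulgI (r ^+ (k - n %% k))); rewrite mulKVg -expgD.
  congr (r ^+ _); rewrite {2}(divn_eq n k) addnCA subnK.
    by rewrite mulnS addnC mulnC.
  exact/ltnW/ltn_pmod.
rewrite defD card_imset ?cardsT ?card_ord ?addn1 // => i j Fij.
have modC a b : a <= b -> r ^+ b * (r ^+ a)^-1 \in C -> a = b %[mod k].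
  move=> le_ab; rewrite -{1}(subnK le_ab) expgD mulgK mem_cycleX_dvdn.
  by rewrite -eqn_mod_dvd // => /eqP.
have lt_k (i0 : 'I_(k %/ 2).+1) : i0 < k.
  by clear -k_gt0; have := ltn_ord i0; lia.
have : r ^+ j \in F i by rewrite Fij mem_dcoset.
case/(rotation_dcoset (Rr i) (Rr j)) => [Cij | ]; last first.
  rewrite -expgD mem_cycleX_dvdn => /dvdnP[c eq_ij].
  (* Both indices are at most [k %/ 2], so [i + j] is 0 or [k]: both are 0, or both equal half of an
     even [k]. *)
  apply/val_inj => /=; have := ltn_ord i; have := ltn_ord j.
  by clear -eq_ij k_gt0; case: c eq_ij => [|[|c]]; rewrite ?mulSn; lia.
(* Both indices are below [k], so congruence modulo [k] is equality; the order of [i] and [j]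
   decides which difference of exponents is formed. *)
apply/val_inj; rewrite /= -(modn_small (lt_k i)) -(modn_small (lt_k j)).
have [le_ij | /ltnW le_ji] := leqP i j; first exact: modC.
by apply/esym/modC => //; rewrite -groupV invMg invgK.
Qed.

End ReflectionDoubleCosets.

(** * The Gelfand pairs of the dihedral group *)

Lemma gelfand_pair_reflection (gT : finGroupType) (G : {group gT})
    (s t u : gT) (m k : nat) :
    1 < m -> dihedral_I2 G s t m -> u \in reflections G s t ->
    0 < k -> k %| m -> let H := <<[set (s * t) ^+ k; u]>>%G in
  gelfand_pair G H /\ double_coset_rank G H = (k %/ 2 + 1)%N.
Proof.
move=> m_gt1 dG Gu k_gt0 k_dvd H.
have [or /normal_sub sRG iR _ _] := dihedral_I2_rotation m_gt1 dG.
have [{}Gu nRu u2 ru] := dihedral_I2_reflection m_gt1 dG Gu.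
have sHG : H \subset G by apply: reflection_sub.
split.
  by apply: gelfand_trick => // g; apply: reflection_dcosetV.
rewrite double_coset_rankE //.
by apply: card_reflection_double_cosets;
  rewrite ?or.
Qed.

Theorem corollary6p2 (gT : finGroupType) (G : {group gT}) (s t : gT) (m : nat)
    (hm : 3 <= m) (hG : dihedral_I2 G s t m) :
  [/\ forall u : gT, u \in reflections G s t ->
        gelfand_pair G <[u]>%G
        /\ double_coset_rank G <[u]>%G
           = (if odd m then (m + 1) %/ 2 else m %/ 2 + 1)%N,
      m = 2 %[mod 4] ->
      forall u : gT, u \in reflections G s t ->
        let z := (s * t) ^+ (m %/ 2) in
        gelfand_pair G <<[set z; u]>>%G
        /\ double_coset_rank G <<[set z; u]>>%G = ((m + 2) %/ 4)%N
    & forall K : {group gT}, K \subset G -> #|G : K| = 2 ->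
        gelfand_pair G K /\ double_coset_rank G K = 2 ].
Proof.
have m_gt1 : 1 < m := ltnW hm.
split=> [u Gu | m4 u Gu z | K sKG iK]; last exact: gelfand_pair_index2.
  have [_ _ _ _ rm] := hG.
  have -> : <[u]>%G = <<[set (s * t) ^+ m; u]>>%G.
    by apply: val_inj; rewrite /= rm -joingE -joing_idr joing1G.
  have [gp ->] := gelfand_pair_reflection m_gt1 hG Gu (ltnW m_gt1) (dvdnn m).
  (* For odd [m] the rounded-down half plus one is [(m + 1) %/ 2]. *)
  by split=> //; case: ifP => odd_m //; lia.
have k_gt0 : 0 < m %/ 2 by lia.
have k_dvd : m %/ 2 %| m by apply/dvdnP; exists 2; lia.
have [gp ->] := gelfand_pair_reflection m_gt1 hG Gu k_gt0 k_dvd.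
(* Writing [m = 4q + 2] gives [m %/ 2 = 2q + 1], so the rank is [q + 1]. *)
by split=> //; lia.
Qed.
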